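(* There are absolute constants $C,C'>0$ such that for all integers $k\ge 2$ and $n\ge k+4$, $$n\left(\frac k2+1\right) \;\le\; M^*_{n,k} \;\le\; n\left(\frac k2+\frac52-\frac1k\right) + C k^2 \;\le\; \frac{nk}{2} + C'(n+k^2).$$
   Context: All graphs are finite, simple and undirected. A $k$-truss is a graph with no isolated vertices in which every edge is contained in at least $k$ triangles. For a graph $G=(V,E)$ and $L\subseteq E$, $G(L)$ is the graph with edge set $L$ and vertex set the set of endpoints of edges of $L$. A graph $G=(V,E)$ is a critical $k$-truss if $G$ is a $k$-truss but $G(E')$ is not a $k$-truss for any non-empty $E'\subsetneq E$. $M^*_{n,k}$ denotes the minimum number of edges in a critical $k$-truss on exactly $n$ vertices, with $M^*_{n,k}=\infty$ if no such graph exists. *)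

(* Defs.v *)
From mathcomp Require Import all_boot all_order all_algebra.
From mathcomp Require Import constructive_ereal reals.

Set Implicit Arguments.
Unset Strict Implicit.
Unset Printing Implicit Defensive.

Import Order.TTheory GRing.Theory Num.Theory.

(* A finite simple undirected graph is a pair (A, E): a vertex set A inside an
   ambient finite type V, and a set E of edges, each a 2-element subset of A. *)
Definition is_sgraph (V : finType) (A : {set V}) (E : {set {set V}}) : bool :=
  [forall e in E, (e \subset A) && (#|e| == 2)].

Definition triangle (V : finType) (E : {set {set V}}) (T : {set V}) : bool :=
  (#|T| == 3) &&
  [forall e : {set V}, (e \subset T) && (#|e| == 2) ==> (e \in E)].

Definition no_isolated (V : finType) (A : {set V}) (E : {set {set V}}) : bool :=
  [forall v in A, exists e in E, v \in e].

Definition truss (V : finType) (k : nat) (A : {set V}) (E : {set {set V}})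
    : bool :=
  [&& is_sgraph A E,
      no_isolated A E &
      [forall e in E, k <= #|[set T : {set V} | triangle E T & e \subset T]|]].

(* The subgraph G(L) induced by a set L of edges is (cover L, L), since cover L
   is the union of the edges in L. *)
Definition critical_truss (V : finType) (k : nat) (A : {set V})
    (E : {set {set V}}) : bool :=
  truss k A E &&
  [forall L : {set {set V}},
     (L != set0) && (L \proper E) ==> ~~ truss k (cover L) L].

(* Up to isomorphism the graphs on exactly n vertices are those with vertex set
   'I_n; the minimum over an empty family is +oo. *)
Definition Mstar (R : realType) (n k : nat) : \bar R :=
  \big[mine/+oo%E]_(E : {set {set 'I_n}} | critical_truss k [set: 'I_n] E)
     (#|E|%:R%:E)%E.

(* Main.v *)
Require Import Defs.
From mathcomp Require Import all_boot all_order all_algebra.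
From mathcomp Require Import constructive_ereal reals.
From mathcomp Require Import zify ring lra.

Set Implicit Arguments.
Unset Strict Implicit.
Unset Printing Implicit Defensive.

Import Order.TTheory GRing.Theory Num.Theory.

(* Lower bound: every vertex of a k-truss has degree at least k + 1, and a vertex
   of degree k + 1 spans with its neighbours a clique on k + 2 vertices; so in a
   critical k-truss on more than k + 2 vertices all degrees are at least k + 2.

   Upper bound: put p = k - 2. Take two nonadjacent apices joined to everything
   else, a cycle cut into m blocks of consecutive edges, and for each block a
   clique of p hubs joined to all the endpoints of the edges of the block. Each
   block has two edges, except one, which is longer in order to reach every
   number of vertices; a two-edge block costs k vertices and (k^2 + 5k - 2) / 2
   edges. This is a k-truss in which every cycle edge lies in exactly k
   triangles. A nonempty subtruss must contain a cycle edge, hence all its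
   triangles, and then, by counting at the next cycle vertex, the next cycle
   edge; so it uses every vertex, and a minimal one is a critical k-truss. *)

(** * Trusses through common neighbours, and the minimum degree of a critical truss *)

Section Trusses.
Context {V : finType}.
Implicit Types (A : {set V}) (E L : {set {set V}}) (x y z : V).

Definition nbrs E x : {set V} := [set y | [set x; y] \in E].

Lemma nbrs_sym E x y : (y \in nbrs E x) = (x \in nbrs E y).
Proof. by rewrite !inE setUC. Qed.

Lemma nbrs_neq A E x y : is_sgraph A E -> y \in nbrs E x -> x != y.
Proof.
move=> /forall_inP hE; rewrite inE => /hE/andP[_].
by rewrite cards2; case: (x != y).
Qed.

Lemma sgraph_edge A E e :
  is_sgraph A E -> e \in E -> exists x y, x != y /\ e = [set x; y].
Proof. by move=> /forall_inP hE /hE/andP[_ /cards2P]. Qed.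

(** Adding a third vertex [z] to the edge is a bijection from common neighbours to triangles over
    it, so the truss condition becomes a count of common neighbours. *)
Lemma card_triangles A E x y : is_sgraph A E -> y \in nbrs E x ->
  #|[set T : {set V} | triangle E T & [set x; y] \subset T]| =
  #|nbrs E x :&: nbrs E y|.
Proof.
move=> hE hxy; have nxy := nbrs_neq hE hxy.
pose f z := z |: [set x; y].
have nz z : z \in nbrs E x :&: nbrs E y -> z \notin [set x; y].
  rewrite inE => /andP[/(nbrs_neq hE) nxz /(nbrs_neq hE) nyz].
  by rewrite !inE negb_or eq_sym nxz eq_sym nyz.
rewrite -(card_in_imset (f := f)); last first.
  move=> z t hz ht eq_zt.
  have : z \in f t by rewrite -eq_zt !inE eqxx.
  by rewrite in_setU1 (negPf (nz z hz)) orbF => /eqP.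
apply: eq_card => T; rewrite inE; apply/andP/imsetP.
- case=> /andP[/eqP cT /forall_inP hT] sT.
  have : #|T :\: [set x; y]| == 1.
    by rewrite cardsD (setIidPr sT) cT cards2 nxy.
  move=> /cards1P[z hz].
  have hzT : z \in T :\: [set x; y] by rewrite hz set11.
  move: (hzT); rewrite !inE negb_or -andbA => /and3P[nzx nzy zT].
  have [xT yT] : x \in T /\ y \in T.
    by split; apply: (subsetP sT); rewrite !inE eqxx ?orbT.
  exists z.
    have nxz : x != z by rewrite eq_sym.
    have nyz : y != z by rewrite eq_sym.
    by rewrite !inE !hT ?cards2 ?nxz ?nyz ?subUset ?sub1set ?xT ?yT ?zT.
  by rewrite /f -hz -{2}(setIidPr sT) setUC setID.
- case=> z hz ->; split; last by rewrite subsetUr.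
  rewrite /triangle cardsU1 (nz z hz) cards2 nxy /=.
  have zx : [set z; x] \in E by move: hz; rewrite !inE setUC => /andP[].
  have zy : [set z; y] \in E by move: hz; rewrite !inE (setUC [set y]) => /andP[].
  move: hxy; rewrite inE => hxy.
  apply/forall_inP => e /andP[se /cards2P[a [b [nab def_e]]]].
  move: se nab; rewrite def_e subUset !sub1set !inE => /andP[].
  by move=> /or3P[]/eqP-> /or3P[]/eqP->; rewrite ?eqxx // setUC.
Qed.

Lemma truss_common k A E x y : truss k A E -> y \in nbrs E x ->
  k <= #|nbrs E x :&: nbrs E y|.
Proof.
move=> /and3P[hE _ /forall_inP hk] hxy.
by rewrite -(card_triangles hE hxy) hk //; move: hxy; rewrite inE.
Qed.

Lemma truss_intro k A E : is_sgraph A E -> no_isolated A E ->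
  (forall x y, y \in nbrs E x -> k <= #|nbrs E x :&: nbrs E y|) ->
  truss k A E.
Proof.
move=> hE hA hk; apply/and3P; split=> //; apply/forall_inP => e he.
have [x [y [_ def_e]]] := sgraph_edge hE he; rewrite def_e in he *.
by rewrite (card_triangles hE) ?hk // inE.
Qed.

Lemma truss_cover k A E : truss k A E -> cover E = A.
Proof.
case/and3P=> /forall_inP hE /forall_inP hA _; apply/setP => x.
apply/bigcupP/idP => [[e /hE/andP[/subsetP sA _] /sA] //|/hA/exists_inP[e he xe]].
by exists e.
Qed.

Lemma nbrsE x y E : ([set x; y] \in E) = (y \in nbrs E x).
Proof. by rewrite inE. Qed.

Lemma truss_neighbor k A E x : truss k A E -> x \in A -> exists y, y \in nbrs E x.
Proof.
case/and3P=> hE /forall_inP hA _ /hA/exists_inP[e he].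
have [a [b [nab def_e]]] := sgraph_edge hE he; rewrite def_e in he *.
by rewrite !inE => /orP[]/eqP->; [exists b|exists a]; rewrite inE // setUC.
Qed.

(* An edge [xy] has [k] common neighbours, which with [y] lie in [nbrs E x]. *)
Lemma truss_degree k A E x : truss k A E -> x \in A -> k < #|nbrs E x|.
Proof.
move=> hT xA; have [y hy] := truss_neighbor hT xA.
have hE : is_sgraph A E by case/and3P: hT.
apply: leq_trans (_ : #|y |: (nbrs E x :&: nbrs E y)| <= _).
  suff yN : y \notin nbrs E x :&: nbrs E y.
    by rewrite cardsU1 yN add1n ltnS (truss_common hT hy).
  by apply/negP; rewrite in_setI => /andP[_ /(nbrs_neq hE)]; rewrite eqxx.
by apply: subset_leq_card; rewrite subUset sub1set hy subsetIl.
Qed.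

Definition clique (K : {set V}) : {set {set V}} :=
  [set e : {set V} | (e \subset K) && (#|e| == 2)].

Lemma nbrs_clique K x y :
  (y \in nbrs (clique K) x) = [&& x \in K, y \in K & x != y].
Proof. by rewrite !inE subUset !sub1set cards2 -andbA; case: (x != y). Qed.

(** Two distinct vertices of a clique have the [k] remaining ones as common neighbours. *)
Lemma clique_truss k (K : {set V}) : #|K| = k + 2 -> truss k K (clique K).
Proof.
move=> cK; apply: truss_intro.
- by apply/forall_inP => e; rewrite inE.
- apply/forall_inP => x xK; have /card_gt0P[y] : 0 < #|K :\ x|.
    by have := cardsD1 x K; rewrite xK; lia.
  rewrite !inE => /andP[nyx yK]; apply/exists_inP; exists [set x; y].
    by rewrite nbrsE nbrs_clique xK yK eq_sym.
  by rewrite !inE eqxx.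
move=> x y; rewrite nbrs_clique => /and3P[xK yK nxy].
apply: leq_trans (_ : #|K :\: [set x; y]| <= _).
  rewrite cardsD cK; have := subset_leq_card (subsetIr K [set x; y]).
  by rewrite cards2 nxy; lia.
apply: subset_leq_card; apply/subsetP => z.
rewrite inE in_set2 negb_or -andbA => /and3P[nzx nzy zK].
by rewrite inE !nbrs_clique xK yK zK ![_ == z]eq_sym nzx nzy.
Qed.

(* A vertex of degree [k + 1] is adjacent to every common neighbour, so its
   closed neighbourhood is a clique on [k + 2] vertices, a smaller truss. *)
Lemma critical_degree k E x : critical_truss k [set: V] E -> k + 2 < #|V| ->
  k + 2 <= #|nbrs E x|.
Proof.
case/andP=> hT /forall_inP hC cV; have hE : is_sgraph setT E by case/and3P: hT.
rewrite addn2 ltn_neqAle (truss_degree hT) ?inE // andbT.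
apply/negP => /eqP cN; pose K := x |: nbrs E x.
have xN : x \notin nbrs E x by apply/negP => /(nbrs_neq hE); rewrite eqxx.
have cK : #|K| = k + 2 by rewrite cardsU1 xN -cN; lia.
have full y z : y \in nbrs E x -> z \in nbrs E x -> y != z -> z \in nbrs E y.
  move=> hy hz nyz.
  have sub : nbrs E x :&: nbrs E y \subset nbrs E x :\ y.
    apply/subsetP => t; rewrite in_setI in_setD1 => /andP[-> /(nbrs_neq hE)].
    by rewrite eq_sym => ->.
  have := truss_common hT hy; have := cardsD1 y (nbrs E x); rewrite hy -cN.
  move=> cD cI; have /eqP eqI : nbrs E x :&: nbrs E y == nbrs E x :\ y.
    by rewrite eqEcard sub; lia.
  have : z \in nbrs E x :\ y by rewrite in_setD1 hz eq_sym nyz.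
  by rewrite -eqI inE => /andP[].
have sKE : clique K \subset E.
  apply/subsetP => e; rewrite inE => /andP[+ /cards2P[a [b [nab def_e]]]].
  rewrite def_e subUset !sub1set !in_setU1 !nbrsE.
  move=> /andP[/predU1P[ax|aN] /predU1P[bx|bN]].
  - by rewrite ax bx eqxx in nab.
  - by rewrite ax.
  - by rewrite bx nbrs_sym.
  - exact: full.
have hK := clique_truss cK.
(* With equality the clique would cover [V], which has more than [k + 2] vertices. *)
have nK : clique K != E.
  apply/eqP => eqKE; move: cV.
  by rewrite -cardsT -(truss_cover hT) -eqKE (truss_cover hK) cK ltnn.
have n0 : clique K != set0.
  apply/eqP => K0; move: cK.
  by rewrite -(truss_cover hK) K0 /cover big_set0 cards0 addn2.
have := hC _ (introT andP (conj n0 _)); rewrite properEneq nK sKE => /(_ isT).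
by rewrite (truss_cover hK) hK.
Qed.

(** Incidences are counted twice: the neighbours of [x] correspond to the edges at [x], and each
    edge has two endpoints. *)
Lemma handshake A E : is_sgraph A E -> \sum_x #|nbrs E x| = 2 * #|E|.
Proof.
move=> hE.
have deg x : #|nbrs E x| = \sum_(e in E) (x \in e).
  rewrite -(card_in_imset (f := fun y => [set x; y])); last first.
    move=> y z /(nbrs_neq hE) nxy _ /setP/(_ y).
    by rewrite !inE eqxx orbT eq_sym (negPf nxy) => /esym/eqP.
  rewrite -sum1_card big_mkcond [RHS]big_mkcond; apply: eq_bigr => e _.
  apply/esym; case: imsetP => [[y hy ->]|nE]; case: ifP => he.
  - by rewrite !inE eqxx.
  - by rewrite nbrsE hy in he.
  - case xe: (x \in e) => //; case: nE.
    have [a [b [_ def_e]]] := sgraph_edge hE he; rewrite def_e in he xe *.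
    by move: xe; rewrite !inE => /orP[]/eqP->; [exists b|exists a];
      rewrite ?inE // setUC.
  - by [].
rewrite (eq_bigr _ (fun x _ => deg x)) exchange_big /= mulnC -sum_nat_const.
apply: eq_bigr => e he; have /forall_inP/(_ e he)/andP[_ /eqP <-] := hE.
by rewrite -sum1_card [RHS]big_mkcond; apply: eq_bigr => x _; case: (x \in e).
Qed.

End Trusses.

(** * The necklace graph and the common neighbours along its edges *)

Section Necklace.
Context {m N p : nat} (b : 'I_N -> 'I_m).
Hypothesis N_gt3 : 3 < N.
(** [b_jump] makes the start of the last edge of a block adjacent to no hub of another block;
    [b_pair] puts three consecutive cycle vertices next to every hub. *)
Hypothesis b_jump : forall i, b i != b (ordS i) -> b (ord_pred i) = b i.
Hypothesis b_pair : forall j, exists i, b i = j /\ b (ordS i) = j.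

Definition vertex : finType := (bool + 'I_N + 'I_m * 'I_p)%type.
Definition apex (c : bool) : vertex := inl (inl c).
Definition cyc (i : 'I_N) : vertex := inl (inr i).
Definition hub (j : 'I_m) (t : 'I_p) : vertex := inr (j, t).

(* The edge from [cyc i] to [cyc (ordS i)] belongs to block [b i]; the hubs of
   a block form a clique joined to the endpoints of the edges of the block. *)
Definition adj (x y : vertex) : bool :=
  match x, y with
  | inl (inl _), inl (inl _) => false
  | inl (inl _), _ | _, inl (inl _) => true
  | inl (inr i), inl (inr i') => (i' == ordS i) || (i == ordS i')
  | inl (inr i), inr (j, _) | inr (j, _), inl (inr i) =>
      (b i == j) || (b (ord_pred i) == j)
  | inr (j, t), inr (j', t') => (j == j') && (t != t')
  end.

Lemma adj_sym x y : adj x y = adj y x.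
Proof.
case: x y => [[c|i]|[j t]] [[c'|i']|[j' t']] //=; first by rewrite orbC.
by rewrite eq_sym (eq_sym t).
Qed.

Lemma val_iter_ordS d (i : 'I_N) : val (iter d (@ordS N) i) = (i + d) %% N.
Proof.
elim: d => [|d IH] /=; first by rewrite addn0 modn_small.
by rewrite IH -addn1 modnDml addn1 addnS.
Qed.

Lemma iter_ordS_neq d (i : 'I_N) : 0 < d < N -> (iter d (@ordS N) i == i) = false.
Proof.
move=> /andP[d0 dN]; apply/negP => /eqP/(congr1 val); rewrite val_iter_ordS.
have := ltn_ord i; case: (ltnP (i + d) N) => h iN; first by rewrite modn_small //=; lia.
rewrite -(subnK h) modnDr modn_small /=; lia.
Qed.

Lemma ordS_neq (i : 'I_N) : (ordS i == i) = false.
Proof. by apply: (@iter_ordS_neq 1); lia. Qed.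

Lemma ordS2_neq (i : 'I_N) : (ordS (ordS i) == i) = false.
Proof. by apply: (@iter_ordS_neq 2); lia. Qed.

Lemma ordS3_neq (i : 'I_N) : (ordS (ordS (ordS i)) == i) = false.
Proof. by apply: (@iter_ordS_neq 3). Qed.

Lemma adj_irr x : adj x x = false.
Proof.
case: x => [[c|i]|[j t]] //=; last by rewrite !eqxx.
by rewrite eq_sym ordS_neq.
Qed.

Definition apices : seq vertex := [:: apex true; apex false].
Definition hubs j : seq vertex := [seq hub j t | t <- enum 'I_p].

Lemma cyc_eq i i' : (cyc i == cyc i') = (i == i').
Proof. by []. Qed.

Lemma hub_eq j t t' : (hub j t == hub j t') = (t == t').
Proof. by rewrite /eq_op /= /eq_op /= eqxx. Qed.

Lemma size_hubs j : size (hubs j) = p.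
Proof. by rewrite size_map size_enum_ord. Qed.

Lemma uniq_hubs j : uniq (hubs j).
Proof. by rewrite map_inj_uniq ?enum_uniq // => t t' []. Qed.

Lemma mem_hubs j x : (x \in hubs j) = if x is inr (j', _) then j' == j else false.
Proof.
apply/mapP/idP => [[t _ ->]|]; first exact: eqxx.
by case: x => [//|[j' t]] /eqP->; exists t; rewrite ?mem_enum.
Qed.

Lemma hubsP j x : reflect (exists t, x = hub j t) (x \in hubs j).
Proof.
by apply: (iffP mapP) => [[t _ ->]|[t ->]]; exists t; rewrite ?mem_enum.
Qed.

Lemma mem_rem_hub j t x :
  (x \in rem (hub j t) (hubs j)) = (x != hub j t) && (x \in hubs j).
Proof. by rewrite mem_rem_uniq ?uniq_hubs // !inE. Qed.

Lemma size_rem_hub j t : size (rem (hub j t) (hubs j)) = p.-1.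
Proof. by rewrite size_rem ?size_hubs // mem_hubs /= eqxx. Qed.

(** An explicit duplicate-free list, so that the bound is proved by naming witnesses. *)
Definition common_nbrs_ge k x y := exists s : seq vertex,
  [/\ uniq s, size s = k & {in s, forall z, adj x z && adj y z}].

Lemma common_nbrs_ge_sym k x y : common_nbrs_ge k x y -> common_nbrs_ge k y x.
Proof.
by case=> s [us ss hs]; exists s; split=> // z /hs; rewrite andbC.
Qed.

(** Witnesses by type of edge: apex and cycle, 2 cycle vertices and [p] hubs; apex and hub, 3 cycle
    vertices and [p - 1] hubs; cycle edge, 2 apices and [p] hubs; cycle and hub, 1 cycle vertex, 2
    apices and [p - 1] hubs; two hubs, 2 apices, 2 cycle vertices and [p - 2] hubs. *)
Lemma adj_common x y : adj x y -> common_nbrs_ge p.+2 x y.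
Proof.
have apex_cyc c i : common_nbrs_ge p.+2 (apex c) (cyc i).
  exists [:: cyc (ordS i), cyc (ord_pred i) & hubs (b i)]; split.
  - rewrite !cons_uniq !inE !mem_hubs uniq_hubs /= orbF andbT cyc_eq.
    by rewrite -[in ordS i](ord_predK i) ordS2_neq.
  - by rewrite /= size_hubs.
  move=> z; rewrite !inE => /or3P[/eqP->|/eqP->|/hubsP[t ->]] /=.
  + by rewrite eqxx.
  + by rewrite ord_predK eqxx orbT.
  + by rewrite eqxx.
have block3 j : exists i, forall t,
    all (fun i => adj (hub j t) (cyc i)) [:: i; ordS i; ordS (ordS i)].
  have [i [bi bSi]] := b_pair j; exists i => t /=.
  by rewrite !ordSK bi bSi eqxx !orbT.
have apex_hub c j t : common_nbrs_ge p.+2 (apex c) (hub j t).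
  have [i hi] := block3 j.
  exists [:: cyc i, cyc (ordS i), cyc (ordS (ordS i)) & rem (hub j t) (hubs j)].
  split.
  - rewrite !cons_uniq !inE !mem_rem_hub !mem_hubs rem_uniq ?uniq_hubs //.
    by rewrite !andbF !orbF !cyc_eq !(eq_sym i) (eq_sym _ (ordS (ordS i))) !ordS_neq ordS2_neq.
  - by rewrite /= size_rem_hub prednK // (leq_ltn_trans _ (ltn_ord t)).
  have /and4P[h1 h2 h3 _] := hi t.
  move=> z; rewrite !inE mem_rem_hub.
  case/or4P => [/eqP->|/eqP->|/eqP->|]; [exact: h1|exact: h2|exact: h3|].
  case/andP=> nzt /hubsP[t' def_z]; move: nzt.
  by rewrite def_z hub_eq /= eqxx eq_sym.
have cyc_succ i : common_nbrs_ge p.+2 (cyc i) (cyc (ordS i)).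
  exists (apices ++ hubs (b i)); split.
  - by rewrite cat_uniq uniq_hubs /= andbT; apply/hasPn => z; rewrite mem_hubs; case: z.
  - by rewrite size_cat size_hubs.
  move=> z; rewrite mem_cat !inE => /orP[/orP[/eqP->|/eqP->]|/hubsP[t ->]] //.
  by rewrite /= ordSK eqxx orbT.
have cyc_hub i j t : adj (cyc i) (hub j t) -> common_nbrs_ge p.+2 (cyc i) (hub j t).
  move=> ij.
  have [i' [ii' i'j]] : exists i', adj (cyc i) (cyc i') /\ adj (hub j t) (cyc i').
    case/orP: ij => /eqP <-; [exists (ordS i)|exists (ord_pred i)];
      by rewrite /= ?ordSK ?ord_predK !eqxx ?orbT.
  exists (cyc i' :: apices ++ rem (hub j t) (hubs j)); split.
  - by rewrite /= !inE !mem_rem_hub !mem_hubs !andbF rem_uniq ?uniq_hubs.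
  - by rewrite /= size_rem_hub prednK // (leq_ltn_trans _ (ltn_ord t)).
  move=> z; rewrite !inE mem_rem_hub.
  case/or4P => [/eqP->|/eqP->|/eqP->|] //; first by rewrite ii' i'j.
  case/andP=> nzt /hubsP[t' def_z]; move: nzt ij.
  by rewrite def_z hub_eq /= eqxx eq_sym => -> ->.
have hub_hub j t t' : t != t' -> common_nbrs_ge p.+2 (hub j t) (hub j t').
  move=> ntt'; have [i hi] := block3 j.
  exists (apices ++ [:: cyc i, cyc (ordS i) & rem (hub j t') (rem (hub j t) (hubs j))]).
  have ht' : hub j t' \in rem (hub j t) (hubs j).
    by rewrite mem_rem_hub mem_hubs /= eqxx andbT hub_eq eq_sym.
  split.
  - rewrite cat_uniq /= !inE !(mem_rem_uniq _ (rem_uniq _ (uniq_hubs j))) !inE.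
    rewrite !mem_rem_hub !mem_hubs !rem_uniq ?uniq_hubs //= !andbT.
    apply/andP; split.
      apply/hasPn => z; rewrite (mem_rem_uniq _ (rem_uniq _ (uniq_hubs j))) inE.
      by rewrite mem_rem_hub mem_hubs; case: z => [//|[? ?]].
    by rewrite cyc_eq eq_sym ordS_neq.
  - rewrite size_cat /= size_rem // size_rem_hub.
    have := ltn_ord t; have := ltn_ord t'; move: ntt'; rewrite -(inj_eq val_inj) /=; lia.
  have /and4P[h1 h2 _ _] := hi t; have /and4P[h1' h2' _ _] := hi t'.
  move=> z; rewrite mem_cat !inE (mem_rem_uniq _ (rem_uniq _ (uniq_hubs j))) inE.
  rewrite mem_rem_hub.
  case/orP => [/orP[/eqP->|/eqP->] //|].
  case/or3P => [/eqP->|/eqP->|]; rewrite ?h1 ?h2 ?h1' ?h2' //.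
  case/and3P=> nzt' nzt /hubsP[t'' def_z]; move: nzt' nzt.
  by rewrite def_z !hub_eq /= eqxx ![t'' == _]eq_sym => -> ->.
case: x y => [[c|i]|[j t]] [[c'|i']|[j' t']].
- by [].
- by move=> _; apply: apex_cyc.
- by move=> _; apply: apex_hub.
- by move=> _; exact/common_nbrs_ge_sym/apex_cyc.
- by case/orP=> /eqP->; [exact: cyc_succ|exact/common_nbrs_ge_sym/cyc_succ].
- exact: cyc_hub.
- by move=> _; exact/common_nbrs_ge_sym/apex_hub.
- by rewrite adj_sym => /cyc_hub/common_nbrs_ge_sym.
- by case/andP=> /eqP-> /(hub_hub j').
Qed.

(** * Subtrusses of the necklace reach every vertex *)

Section Spanning.
Variable R : rel vertex.
Hypothesis R_adj : forall x y, R x y -> adj x y.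
Hypothesis R_sym : forall x y, R x y = R y x.
(** [R] stands for adjacency in a subtruss. That an edge has at least [p + 2] common neighbours is
    phrased as: no shorter list exhausts them. *)
Hypothesis R_common : forall x y (s : seq vertex), R x y -> size s < p.+2 ->
  exists z, [/\ z \notin s, R x z & R y z].

(** A third cycle vertex would close a triangle, impossible as [N > 3]. A hub of another block would
    belong to both the previous and the next edge, against [b_jump]. *)
Lemma cyc_common i x : adj (cyc i) x -> adj (cyc (ordS i)) x ->
  x \in apices ++ hubs (b i).
Proof.
rewrite mem_cat !inE mem_hubs; case: x => [[[]|i']|[j t]] //=.
  case/orP=> /eqP e1 /orP[] /eqP e2.
  - by move/eqP: e1; rewrite e2 ordS_neq.
  - by move/eqP: e1; rewrite -(ordS_inj e2) eq_sym ordS_neq.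
  - by move/eqP: e1; rewrite e2 eq_sym ordS3_neq.
  - by move/eqP: e1; rewrite -(ordS_inj e2) eq_sym ordS_neq.
rewrite ordSK (eq_sym j); case: (eqVneq (b i) j) => //= nbj /eqP bp.
rewrite orbF => /eqP bS; have := @b_jump i.
by rewrite bS bp nbj => /(_ isT) e; rewrite -e eqxx in nbj.
Qed.

Lemma cyc_tight i x : R (cyc i) (cyc (ordS i)) -> x \in apices ++ hubs (b i) ->
  R (cyc i) x /\ R (cyc (ordS i)) x.
Proof.
(* There are only [p + 2] candidates; once [x] is removed, the [p + 1] left are too few, and the
   common neighbour outside them must be [x]. *)
move=> hi hx; pose s := rem x (apices ++ hubs (b i)).
have us : uniq (apices ++ hubs (b i)).
  by rewrite cat_uniq uniq_hubs /= andbT; apply/hasPn => z; rewrite mem_hubs; case: z.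
have [|z [zs h1 h2]] := R_common (s := s) hi.
  by rewrite /s size_rem // size_cat size_hubs.
suff -> : x = z by [].
move: zs; rewrite mem_rem_uniq // inE (cyc_common (R_adj h1) (R_adj h2)) andbT.
by rewrite negbK => /eqP.
Qed.

(** The apices and the other hubs of block [j] number only [p + 1], so some common neighbour lies on
    the cycle. *)
Lemma hub_cyc j t x : R (hub j t) x -> exists i, R (hub j t) (cyc i) /\ R x (cyc i).
Proof.
move=> hx; have [|z [zs h1 h2]] :=
    R_common (s := apices ++ rem (hub j t) (hubs j)) hx.
  by rewrite size_cat size_rem_hub /=; have := ltn_ord t; lia.
have := R_adj h1; move: zs h1 h2; rewrite mem_cat mem_rem_hub mem_hubs !inE.
case: z => [[[]|i]|[j' t']] //=; first by exists i.
move=> zs _ _ /andP[/eqP ej ntt']; move: zs.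
by rewrite -ej eqxx andbT -[inr _]/(hub j t') hub_eq eq_sym ntt'.
Qed.

Lemma cyc_propagates i : R (cyc i) (cyc (ordS i)) ->
  R (cyc (ordS i)) (cyc (ordS (ordS i))).
Proof.
move=> hi; apply/negPn/negP => nR.
have [_ hv] := cyc_tight (x := apex true) hi isT.
(* Without the next edge, [cyc i] is the only cycle vertex [R]-adjacent to [cyc (ordS i)]. The edge
   to the apex then needs a hub of a new block, and by [hub_cyc] that hub must be adjacent to
   [cyc i], which [b_jump] forbids. *)
have nbr i' : R (cyc (ordS i)) (cyc i') -> i' = i.
  move=> hR; case/orP: (R_adj hR) => /eqP e; last by rewrite (ordS_inj e).
  by move: nR; rewrite -e hR.
have [|z [zs h1 h2]] := R_common (s := cyc i :: hubs (b i)) hv.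
  by rewrite /= size_hubs.
move: zs (R_adj h1); rewrite inE mem_hubs negb_or.
case: z h1 h2 => [[c|i']|[j t]] h1 h2; first by have := R_adj h2.
  by rewrite -[inl _]/(cyc i') cyc_eq (nbr i') ?eqxx.
case/andP=> _ /=; rewrite eq_sym ordSK => /negPf nbj; rewrite nbj orbF => /eqP bS.
have [i' [h3 h4]] : exists i', R (hub j t) (cyc i') /\ R (cyc (ordS i)) (cyc i').
  by apply: hub_cyc; rewrite R_sym.
by move: (R_adj h3); rewrite (nbr i' h4) /= nbj /= b_jump ?bS nbj.
Qed.

Lemma ex_cyc_edge x y : R x y -> exists i, R (cyc i) (cyc (ordS i)).
Proof.
have cc i i' : R (cyc i) (cyc i') -> exists i, R (cyc i) (cyc (ordS i)).
  move=> hR; case/orP: (R_adj hR) => /eqP e; first by exists i; rewrite -e.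
  by exists i'; rewrite -e R_sym.
(* Using [hub_cyc] twice gives first an edge from the hub to the cycle, then a triangle on it with a
   second cycle vertex. *)
have hub_edge j t z : R (hub j t) z -> exists i, R (cyc i) (cyc (ordS i)).
  case/hub_cyc=> i [+ _]; rewrite R_sym => /[dup]; rewrite R_sym => /hub_cyc.
  by case=> i' [_ h] _; apply: cc h.
have cyc_edge i z : R (cyc i) z -> exists i, R (cyc i) (cyc (ordS i)).
  case: z => [[c|i']|[j t]] h; last by apply: (hub_edge j t); rewrite R_sym; exact: h.
    have [|z [_ h1 h2]] := R_common (s := [::]) h; first by [].
    case: z h1 h2 => [[c'|i']|[j t]] h1 h2; first by have := R_adj h2.
      exact: cc h1.
    by apply: (hub_edge j t); rewrite R_sym; exact: h1.
  exact: cc h.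
case: x => [[c|i]|[j t]] h; [|exact: cyc_edge h|exact: hub_edge h].
case: y h => [[c'|i]|[j t]] h; first by have := R_adj h.
  by apply: (cyc_edge i); rewrite R_sym; exact: h.
by apply: (hub_edge j t); rewrite R_sym; exact: h.
Qed.

(** One cycle edge propagates around the whole cycle, and then [cyc_tight] reaches the apices and
    all hubs. *)
Lemma spanning x y z : R x y -> exists t, R z t.
Proof.
move=> /ex_cyc_edge[i hi].
have all_cyc i' : R (cyc i') (cyc (ordS i')).
  have hd d : R (cyc (iter d (@ordS N) i)) (cyc (ordS (iter d (@ordS N) i))).
    by elim: d => //= d; apply: cyc_propagates.
  have [d <-] : exists d, iter d (@ordS N) i = i'; last exact: hd.
  (* This number of steps is congruent to [i' - i] modulo [N] and avoids a truncated subtraction. *)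
  exists (i' + (N - i)); apply: val_inj; rewrite val_iter_ordS /=.
  have -> : i + (i' + (N - i)) = i' + N by have := ltn_ord i; lia.
  by rewrite modnDr modn_small.
case: z => [[c|i']|[j t]].
- exists (cyc i); rewrite R_sym.
  have hx : apex c \in apices ++ hubs (b i) by case: c.
  by have [] := cyc_tight (all_cyc i) hx.
- exists (cyc (ordS i')); exact: all_cyc.
- have [i' [bi' _]] := b_pair j; exists (cyc i'); rewrite R_sym.
  have hx : hub j t \in apices ++ hubs (b i') by rewrite mem_cat mem_hubs /= bi' eqxx.
  by have [] := cyc_tight (all_cyc i') hx.
Qed.

End Spanning.

(** * The necklace as a set of edges, transported along a bijection [g], and its edge count *)

Section Edges.
Context {V : finType} (g : vertex -> V) (g' : V -> vertex).
Hypotheses (gK : cancel g g') (g'K : cancel g' g).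

Let g_inj : injective g := can_inj gK.

Definition edge x y : {set V} := [set g x; g y].

Definition edges : {set {set V}} :=
  [set edge q.1 q.2 | q in [set q : vertex * vertex | adj q.1 q.2]].

Lemma adj_neq x y : adj x y -> x != y.
Proof. by apply: contraTneq => ->; rewrite adj_irr. Qed.

Lemma nbrs_edges x y : (g y \in nbrs edges (g x)) = adj x y.
Proof.
rewrite inE; apply/imsetP/idP => [[[a c]]|hxy]; last first.
  by exists (x, y); rewrite ?inE.
rewrite inE /= => hac eqE; have := adj_neq hac.
have : g a \in [set g x; g y] by rewrite eqE !inE eqxx.
have : g c \in [set g x; g y] by rewrite eqE !inE eqxx orbT.
rewrite !inE !(inj_eq g_inj) => /orP[]/eqP ec /orP[]/eqP ea; rewrite ec ea in hac *.
- by rewrite eqxx.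
- by rewrite adj_sym.
- by [].
- by rewrite eqxx.
Qed.

Lemma edges_sgraph : is_sgraph [set: V] edges.
Proof.
apply/forall_inP => e /imsetP[[x y]]; rewrite inE /= => hxy ->.
by rewrite subsetT cards2 (inj_eq g_inj) adj_neq.
Qed.

Lemma edges_truss : truss p.+2 [set: V] edges.
Proof.
apply: truss_intro; first exact: edges_sgraph.
  apply/forall_inP => v _; rewrite -(g'K v).
  have [y hy] : exists y, adj (g' v) y.
    case: (g' v) => [[c|i]|[j t]]; [|by exists (apex true)..].
    by exists (cyc (Ordinal (ltn_trans (isT : 0 < 3) N_gt3))).
  apply/exists_inP; exists (edge (g' v) y); last by rewrite !inE eqxx.
  by rewrite nbrsE nbrs_edges.
move=> u v; rewrite -(g'K u) -(g'K v) nbrs_edges => /adj_common[s [us <- hs]].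
rewrite -(size_map g) -(card_uniqP _); last by rewrite map_inj_uniq.
apply/subset_leq_card/subsetP => w /mapP[z /hs hz ->].
by rewrite inE !nbrs_edges.
Qed.

(* An edge of the cycle lies in exactly [k = p + 2] triangles, so a subtruss
   containing it contains these triangles; counting triangles at the next cycle
   vertex then yields the next edge of the cycle. *)
Lemma subtruss_spanning A (L : {set {set V}}) :
  truss p.+2 A L -> L \subset edges -> L != set0 -> cover L = [set: V].
Proof.
move=> hL sL /set0Pn[e he]; pose R x y := g y \in nbrs L (g x).
have R_adj x y : R x y -> adj x y.
  by rewrite -nbrs_edges /R -!nbrsE; apply: (subsetP sL).
have R_sym x y : R x y = R y x by rewrite /R nbrs_sym.
have R_common x y (s : seq vertex) : R x y -> size s < p.+2 ->
    exists z, [/\ z \notin s, R x z & R y z].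
  move=> /(truss_common hL) hk hs.
  have : ~~ (nbrs L (g x) :&: nbrs L (g y) \subset [seq g z | z <- s]).
    apply: contraL hs => /subset_leq_card hc; rewrite -leqNgt.
    by rewrite -(size_map g) (leq_trans hk) // (leq_trans hc) // card_size.
  case/subsetPn => v; rewrite -(g'K v) inE => /andP[h1 h2].
  by rewrite (mem_map g_inj) => h3; exists (g' v).
have /imsetP[[x y] _ def_e] := subsetP sL e he; rewrite def_e in he.
have hR : R x y by rewrite /R -nbrsE.
apply/setP => v; rewrite inE; apply/bigcupP.
have [t] := spanning R_adj R_sym R_common (g' v) hR.
rewrite /R -nbrsE g'K => hv; exists [set v; g t] => //.
by rewrite !inE eqxx.
Qed.

(** [stop j] is the cycle vertex where block [j] ends. Each cycle vertex sees the hubs of its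
    outgoing edge ([S4]), and only at these ends also those of another block ([S5]). An upper bound
    suffices, so the six families need not be shown disjoint. *)
Lemma card_edges (stop : 'I_m -> 'I_N) :
  (forall i, b (ord_pred i) != b i -> i = stop (b (ord_pred i))) ->
  #|edges| <= 3 * N + N * p + 3 * (m * p) + m * 'C(p, 2).
Proof.
move=> b_stop.
pose S1 := [set edge (cyc i) (cyc (ordS i)) | i : 'I_N].
pose S2 := [set edge (apex q.1) (cyc q.2) | q : bool * 'I_N].
pose S3 := [set edge (apex q.1) (hub q.2.1 q.2.2) | q : bool * ('I_m * 'I_p)].
pose S4 := [set edge (cyc q.1) (hub (b q.1) q.2) | q : 'I_N * 'I_p].
pose S5 := [set edge (cyc (stop q.1)) (hub q.1 q.2) | q : 'I_m * 'I_p].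
pose S6 := [set g @: (hub q.1 @: q.2) |
  q : 'I_m * {set 'I_p} in setX [set: 'I_m] [set T : {set 'I_p} | #|T| == 2]].
have edgeC x y : edge x y = edge y x by rewrite /edge setUC.
have sE : edges \subset S1 :|: S2 :|: S3 :|: S4 :|: S5 :|: S6.
  apply/subsetP => e /imsetP[[x y]]; rewrite inE /= => + ->.
  have h2 c i : edge (apex c) (cyc i) \in S2 by apply/imsetP; exists (c, i).
  have h3 c j t : edge (apex c) (hub j t) \in S3 by apply/imsetP; exists (c, (j, t)).
  have h45 i j t : adj (cyc i) (hub j t) -> edge (cyc i) (hub j t) \in S4 :|: S5.
    rewrite /= inE; have [<- _|nbj /= /eqP bp] := eqVneq (b i) j.
      by apply/orP; left; apply/imsetP; exists (i, t).
    apply/orP; right; apply/imsetP; exists (j, t) => //=.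
    by rewrite -bp -b_stop // bp eq_sym.
  case: x y => [[c|i]|[j t]] [[c'|i']|[j' t']]; rewrite !in_setU => hxy.
  - by [].
  - by rewrite h2 !orbT.
  - by rewrite h3 !orbT.
  - by rewrite edgeC h2 !orbT.
  - have -> // : edge (cyc i) (cyc i') \in S1.
    case/orP: hxy => /eqP->; last rewrite edgeC.
      by apply/imsetP; exists i.
    by apply/imsetP; exists i'.
  - by have := h45 _ _ _ hxy; rewrite inE => /orP[]->; rewrite ?orbT.
  - by rewrite edgeC h3 !orbT.
  - rewrite edgeC; rewrite adj_sym in hxy.
    by have := h45 _ _ _ hxy; rewrite inE => /orP[]->; rewrite ?orbT.
  - case/andP: hxy => /eqP <- ntt'; apply/orP; right.
    apply/imsetP; exists (j, [set t; t']); first by rewrite !inE cards2 ntt'.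
    by rewrite /= imsetU1 imset_set1 imsetU1 imset_set1.
apply: leq_trans (subset_leq_card sE) _.
have cU (A B : {set {set V}}) : #|A :|: B| <= #|A| + #|B| by rewrite leq_card_setU.
have h1 : #|S1| <= N by rewrite (leq_trans (leq_imset_card _ _)) ?card_ord.
have h2 : #|S2| <= 2 * N.
  by rewrite (leq_trans (leq_imset_card _ _)) // card_prod card_bool card_ord.
have h3 : #|S3| <= 2 * (m * p).
  by rewrite (leq_trans (leq_imset_card _ _)) // !card_prod card_bool !card_ord.
have h4 : #|S4| <= N * p.
  by rewrite (leq_trans (leq_imset_card _ _)) // card_prod !card_ord.
have h5 : #|S5| <= m * p.
  by rewrite (leq_trans (leq_imset_card _ _)) // card_prod !card_ord.
have h6 : #|S6| <= m * 'C(p, 2).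
  by rewrite (leq_trans (leq_imset_card _ _)) // cardsX cardsT card_draws !card_ord.
have -> : 3 * N + N * p + 3 * (m * p) + m * 'C(p, 2) =
    N + 2 * N + 2 * (m * p) + N * p + m * p + m * 'C(p, 2) by clear; lia.
by do 5![apply: leq_trans (cU _ _) _; apply: leq_add => //].
Qed.

End Edges.
End Necklace.

(** * A concrete division of the cycle into blocks *)

Section Blocks.
Context (m' r : nat).
Let N := (2 * m' + r).+2.

(* All blocks have two edges, except the last one, which has [r + 2]. *)
Definition block (i : 'I_N) : 'I_m'.+1 := inord (minn (i %/ 2) m').

Lemma val_block i : block i = minn (i %/ 2) m' :> nat.
Proof. by rewrite inordK // ltnS geq_minr. Qed.

Lemma val_ordS (i : 'I_N) : ordS i = (if i.+1 < N then i.+1 else 0) :> nat.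
Proof.
case: ltnP => h /=; first by rewrite modn_small.
by have -> : i.+1 = N by [apply/eqP; rewrite eqn_leq h ltn_ord]; rewrite modnn.
Qed.

Lemma val_ord_pred (i : 'I_N) :
  ord_pred i = (if i == 0 :> nat then N.-1 else i.-1) :> nat.
Proof.
case: eqP => [i0|/eqP i0]; first by rewrite /= i0 modn_small.
have -> : val (ord_pred i) = (i + N).-1 %% N by [].
have -> : (i + N).-1 = i.-1 + N by lia.
by rewrite modnDr modn_small // (leq_ltn_trans (leq_pred i)).
Qed.

Lemma block_jump i : block i != block (ordS i) -> block (ord_pred i) = block i.
Proof.
rewrite -(inj_eq val_inj) /= => h; apply: val_inj => /=; move: h.
rewrite !val_block val_ordS val_ord_pred; have := ltn_ord i; rewrite /N.
by move: (nat_of_ord i) => a; case: (ltnP a.+1); case: (a =P 0); lia.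
Qed.

Lemma block_pair j : exists i, block i = j /\ block (ordS i) = j.
Proof.
have jm := ltn_ord j; have hj : 2 * j < N by rewrite /N; lia.
(* Edges [2 * j] and [2 * j + 1] lie in block [j]. *)
exists (Ordinal hj); split; apply: val_inj; rewrite /= val_block ?val_ordS /=.
  by lia.
by rewrite /N; case: (ltnP _.+1); lia.
Qed.

(** The last block ends at vertex 0, where the cycle closes. *)
Definition block_stop (j : 'I_m'.+1) : 'I_N :=
  inord (if j < m' then 2 * j.+1 else 0).

Lemma val_block_stop j :
  block_stop j = (if j < m' then 2 * j.+1 else 0) :> nat.
Proof. by rewrite inordK //; case: (ltnP j m'); lia. Qed.

Lemma block_stopE i :
  block (ord_pred i) != block i -> i = block_stop (block (ord_pred i)).
Proof.
rewrite -(inj_eq val_inj) /= => h; apply: val_inj => /=; move: h.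
have := ltn_ord i; rewrite val_block_stop !val_block val_ord_pred /N.
move: (nat_of_ord i) => a.
by case: (_ < m') / ltnP; case: (a =P 0); lia.
Qed.

End Blocks.

(** * The two bounds on [Mstar] *)

Section Mstar.
Local Open Scope ring_scope.
Variable R : realType.

(* A minimal nonempty subtruss of [E] is critical and, by hypothesis, uses all
   the vertices. *)
Lemma Mstar_le n k (E : {set {set 'I_n}}) : E != set0 ->
    truss k [set: 'I_n] E ->
    (forall L, truss k (cover L) L -> L \subset E -> L != set0 ->
      cover L = [set: 'I_n]) ->
  (Mstar R n k <= #|E|%:R%:E)%E.
Proof.
move=> E0 hE hL; pose P (L : {set {set 'I_n}}) := (L != set0) && truss k (cover L) L.
have [|L hm sLE] := @minset_exists _ P E; first by rewrite /P E0 (truss_cover hE).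
have /minsetP[/andP[L0 LT] Lmin] := hm.
have crit : critical_truss k [set: 'I_n] L.
  rewrite /critical_truss -{1}(hL L) // LT /=.
  apply/forall_inP => L' /andP[L'0 /[dup] /proper_sub sL' pL']; apply/negP => hL'.
  have := Lmin L' _ sL'; rewrite /P L'0 hL' => /(_ isT) eqL.
  by rewrite eqL properxx in pL'.
apply: le_trans (Order.TotalTheory.bigmin_le_cond _ _ crit) _.
by rewrite lee_fin ler_nat subset_leq_card.
Qed.

Lemma Mstar_ge n k : (k + 4 <= n)%N ->
  ((n%:R * (k%:R / 2 + 1) : R)%:E <= Mstar R n k)%E.
Proof.
(* The default value [+oo] of the minimum satisfies the bound trivially. *)
move=> kn; apply/Order.TotalTheory.bigmin_geP; split=> [|E hE]; first exact: leey.
rewrite lee_fin.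
have hs : is_sgraph setT E by case/andP: hE => /and3P[].
have : (n * (k + 2) <= 2 * #|E|)%N.
  rewrite -(handshake hs) -[n in (n * _)%N]card_ord -sum_nat_const leq_sum // => x _.
  by apply: critical_degree; rewrite ?card_ord //; lia.
rewrite -(ler_nat R) !natrM natrD; lra.
Qed.

(** The bound on [2 * c] is twice that of [card_edges] with [m = m'.+1] blocks and [N = 2 * m + r],
    collected by [m] and [r]. *)
Lemma Mstar_necklace m' r p : (1 < 2 * m' + r)%N ->
  exists2 c : nat, (Mstar R (2 + (2 * m' + r).+2 + m'.+1 * p) p.+2 <= c%:R%:E)%E &
  (2 * c <= m'.+1 * (p ^ 2 + 9 * p + 12) + 2 * (r * (p + 3)))%N.
Proof.
move=> h4; set n := (_ + _ + _)%N.
have cV : #|@vertex m'.+1 (2 * m' + r).+2 p| = n.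
  by rewrite card_sum card_sum card_prod card_bool !card_ord.
pose g x : 'I_n := cast_ord cV (enum_rank x).
pose g' y := enum_val (cast_ord (esym cV) y).
have gK : cancel g g' by move=> x; rewrite /g' /g cast_ordK enum_rankK.
have g'K : cancel g' g by move=> x; rewrite /g' /g enum_valK cast_ordKV.
have N4 : (3 < (2 * m' + r).+2)%N by [].
have hT := edges_truss N4 (@block_pair m' r) gK g'K.
exists #|edges (@block m' r) g|.
  apply: Mstar_le => //.
    apply/eqP => E0; move: hT => /truss_cover; rewrite E0 /cover big_set0 => /setP.
    by move=> /(_ (g (inl (inl true)))); rewrite !inE.
  move=> L; exact: (subtruss_spanning N4 (@block_jump m' r) (@block_pair m' r) gK g'K).
have := card_edges g (@block_stopE m' r).
have : (2 * 'C(p, 2) <= p * p.-1)%N by rewrite bin2; lia.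
have : (p * p.-1 + p = p ^ 2)%N by case: (p) => //= q; lia.
nia.
Qed.

(** Besides the two apices there are [q] blocks of [k] vertices (2 on the cycle, [k - 2] hubs); the
    remainder [r] lengthens the last block. *)
Lemma Mstar_upper n k : (2 <= k)%N -> (k + 4 <= n)%N ->
  (Mstar R n k <=
     (n%:R * (k%:R / 2 + 5 / 2 - 1 / k%:R) + 2 * k%:R ^+ 2 : R)%:E)%E.
Proof.
move=> k2 kn; set q := ((n - 2) %/ k)%N; set r := ((n - 2) %% k)%N.
have r_lt : (r < k)%N by rewrite ltn_mod; lia.
have def_n : (n - 2 = q * k + r)%N by exact: divn_eq.
have q0 : (0 < q)%N by rewrite divn_gt0; lia.
(* The cycle must have at least 4 vertices; when [q = 1], the bound [k + 4 <= n] forces [r >= 2]. *)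
have h4 : (1 < 2 * q.-1 + r)%N.
  by case: (ltnP 1 q) => hq; [lia|have q1 : q = 1%N by [lia]; rewrite q1 in def_n *; lia].
have [c] := Mstar_necklace (k - 2) h4.
have -> : (2 + (2 * q.-1 + r).+2 + q.-1.+1 * (k - 2) = n)%N by nia.
have -> : ((k - 2).+2 = k)%N by lia.
move=> h hc; apply: le_trans h _; rewrite lee_fin.
(* A block contributes [k ^ 2 + 5 * k - 2] to [2 * c], with the [- 2] moved to the left; the
   remainder term is at most [2 * k * (k + 1) <= 4 * k ^ 2], whence the constant 2. *)
have {}hc : (2 * c + 2 * q <= q * (k ^ 2 + 5 * k) + 4 * k ^ 2)%N.
  have rk : (r * (k + 1) <= k * (k + 1))%N by rewrite leq_mul2r (ltnW r_lt) orbT.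
  have kk : (k <= k * k)%N by rewrite leq_pmulr //; lia.
  have e : (k ^ 2 + 5 * k = (k - 2) ^ 2 + 9 * (k - 2) + 12 + 2)%N by nia.
  rewrite e mulnDr; move: hc; rewrite (prednK q0) (_ : k - 2 + 3 = k + 1)%N; last by lia.
  lia.
have k0 : 0 < k%:R :> R by rewrite ltr0n; lia.
have qn : q%:R <= n%:R / k%:R :> R.
  by rewrite ler_pdivlMr // -natrM ler_nat; lia.
have -> : n%:R * (k%:R / 2 + 5 / 2 - 1 / k%:R) =
    (n%:R / k%:R) * (k%:R ^+ 2 + 5 * k%:R - 2) / 2 :> R.
  by field; rewrite gt_eqF.
move: hc; rewrite -(ler_nat R) !(natrD, natrX, natrM) => hc.
(* This factor being nonnegative, [q] may be replaced by the larger [n / k]. *)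
have k4 : 0 <= k%:R ^+ 2 + 5 * k%:R - 2 :> R.
  have : 2 <= k%:R :> R by rewrite ler_nat.
  nra.
have := ler_wpM2r k4 qn; lra.
Qed.

End Mstar.

Local Open Scope ring_scope.

Theorem theorem3p8 (R : realType) :
  exists C C' : R, 0 < C /\ 0 < C' /\
    forall n k : nat, (2 <= k)%N -> (k + 4 <= n)%N ->
      [/\ ((n%:R * (k%:R / 2 + 1) : R)%:E <= Mstar R n k)%E,
          (Mstar R n k <=
             (n%:R * (k%:R / 2 + 5 / 2 - 1 / k%:R) + C * k%:R ^+ 2 : R)%:E)%E
        & n%:R * (k%:R / 2 + 5 / 2 - 1 / k%:R) + C * k%:R ^+ 2
            <= n%:R * k%:R / 2 + C' * (n%:R + k%:R ^+ 2) :> R].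
Proof.
(* [5 / 2] absorbs both the coefficient [5 / 2] of [n] and the coefficient 2 of [k ^ 2]. *)
exists 2, (5 / 2); split; first by lra.
split; first by lra.
move=> n k k2 kn; split; [exact: Mstar_ge | exact: Mstar_upper |].
have h1 : 0 <= n%:R * (1 / k%:R) :> R by rewrite mulr_ge0 ?divr_ge0 ?ler0n.
have h2 : 0 <= k%:R ^+ 2 :> R by rewrite exprn_ge0 ?ler0n.
by rewrite mulrBr !mulrDr mulrA; lra.
Qed.
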